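(* There is an absolute constant $C > 0$ such that the following holds. Let $n \geq 1$, let $\mathcal H$ be a complex Hilbert space, $|\psi\rangle \in \mathcal H$ a state, and $(X_1, Z_1), \ldots, (X_n, Z_n)$ qubits in $\mathcal H$. If the $n$-qubit testing protocol (defined in the context), run on $|\psi\rangle$ with these qubits, accepts with probability at least $1 - \epsilon$ for some $\epsilon \geq 0$, then $$\dim \mathcal H \geq \big(1 - C n^2 \epsilon\big)\, 2^n .$$
   Context: A reflection is a Hermitian operator that squares to the identity. A qubit in a Hilbert space is a pair $(X,Z)$ of anti-commuting reflections ($XZ + ZX = 0$). A state is a unit vector. Measuring a reflection $R$ on a state $|\phi\rangle$ gives outcome $\pm 1$ with probability $\|\frac12(\mathbf 1 \pm R)|\phi\rangle\|^2$, leaving the normalized state proportional to $\frac12(\mathbf 1 \pm R)|\phi\rangle$. The $n$-qubit testing protocol, for a state $|\psi\rangle \in \mathcal H$ and qubits $(X_1,Z_1),\ldots,(X_n,Z_n)$ in $\mathcal H$: (1) Starting from $|\psi\rangle$, with equal probabilities $1/2$, measure all the reflections successively, either in the order $X_1, Z_1, X_2, Z_2, \ldots, X_n, Z_n$, or in the order $Z_1, X_1, Z_2, X_2, \ldots, Z_n, X_n$. (2) Pick a uniformly random index $j \in \{1,\ldots,n\}$. If the first order was used in step (1), measure $Z_j$; if the second order was used, measure $X_j$. Accept if the result equals the result of that same operator's measurement in step (1); otherwise reject. *)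

(* Defs.v *)
From HB Require Import structures.
From mathcomp Require Import all_boot all_order all_algebra.
From mathcomp Require Import complex.
From mathcomp Require Import all_classical all_reals all_analysis.

Set Implicit Arguments.
Unset Strict Implicit.
Unset Printing Implicit Defensive.

Import Order.TTheory GRing.Theory Num.Theory.
Import numFieldNormedType.Exports.

Local Open Scope ring_scope.
Local Open Scope complex_scope.

(* [inner] is linear in its first argument and conjugate-linear in its second;
   completeness is that of the norm. *)
Record hilbertType (R : realType) := HilbertType {
  hilbert_sort :> completeNormedModType R[i];
  inner : {dot hilbert_sort for Num.conj};
  innerE : forall v : hilbert_sort, inner v v = `|v| ^+ 2
}.

Section Hilbert.
Context {R : realType} {H : hilbertType R}.
Implicit Types (v : H) (A B : H -> H).

(* The norm of [H] takes its values in [R[i]], where it is real. *)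
Definition rnorm v : R := complex.Re `|v|.

Definition lin_indep d (e : 'I_d -> H) : Prop :=
  forall c : 'I_d -> R[i], \sum_i c i *: e i = 0 -> forall i, c i = 0.

(* No boundedness requirement is needed: an everywhere defined Hermitian
   operator that squares to the identity preserves the norm. *)
Definition reflection (A : {linear H -> H}) : Prop :=
  (forall u v, inner H (A u) v = inner H u (A v)) /\ (forall v, A (A v) = v).

Definition qubit (X Z : {linear H -> H}) : Prop :=
  [/\ reflection X, reflection Z & forall v, X (Z v) + Z (X v) = 0].

Definition state v : Prop := rnorm v = 1.

(* Outcomes are encoded by booleans: [b] stands for the value (-1) ^+ b, that
   is, [false] for +1 and [true] for -1. *)
Definition meas_vec A (b : bool) v : H := 2^-1 *: (v + (-1) ^+ b *: A v).

Definition meas_prob A b v : R := rnorm (meas_vec A b v) ^+ 2.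

(* If the outcome has probability 0, this is the junk value 0; it is always
   weighted by that probability. *)
Definition meas_post A b v : H := `|meas_vec A b v|^-1 *: meas_vec A b v.

(* Successive measurements: [s] lists the measured operators, from first to
   last, with their outcomes. *)
Fixpoint seq_prob (s : seq ((H -> H) * bool)) v : R :=
  if s is (A, b) :: s' then meas_prob A b v * seq_prob s' (meas_post A b v)
  else 1.

Fixpoint seq_post (s : seq ((H -> H) * bool)) v : H :=
  if s is (A, b) :: s' then seq_post s' (meas_post A b v) else v.

Section Protocol.
Variable n : nat.

(* The order A_0, B_0, A_1, B_1, ..., where [o i] is the pair of outcomes of
   A_i and B_i. *)
Definition pass (A B : 'I_n -> {linear H -> H}) (o : {ffun 'I_n -> bool * bool})
    : seq ((H -> H) * bool) :=
  flatten [seq [:: (A i : H -> H, (o i).1); (B i : H -> H, (o i).2)]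
          | i <- enum 'I_n].

(* Acceptance probability given that the order A_0, B_0, A_1, B_1, ... was
   used: after a uniformly random choice of j, B_j is measured again and has
   to give the same outcome as before. *)
Definition accept_prob_order (A B : 'I_n -> {linear H -> H}) v : R :=
  \sum_(o : {ffun 'I_n -> bool * bool})
    seq_prob (pass A B o) v *
    (n%:R^-1 * \sum_(j < n) meas_prob (B j) (o j).2 (seq_post (pass A B o) v)).

Definition accept_prob (X Z : 'I_n -> {linear H -> H}) v : R :=
  2^-1 * accept_prob_order X Z v + 2^-1 * accept_prob_order Z X v.

End Protocol.
End Hilbert.

(* The dimension is the supremum of the sizes of the finite linearly
   independent families; it is +oo for an infinite-dimensional space. *)
Definition hdim (R : realType) (H : hilbertType R) : \bar R :=
  ereal_sup [set x | exists d (e : 'I_d -> H), lin_indep e /\ x = d%:R%:E].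

(* Main.v *)
From HB Require Import structures.
Require Import Defs.
From mathcomp Require Import all_boot all_order all_algebra.
From mathcomp Require Import complex ring lra.
From mathcomp Require Import all_classical all_reals all_analysis.

Set Implicit Arguments.
Unset Strict Implicit.
Unset Printing Implicit Defensive.

Import Order.TTheory GRing.Theory Num.Theory.
Import numFieldNormedType.Exports.

Local Open Scope ring_scope.

(** Let [f o] be the unnormalized state left by the pass X_1, Z_1, ..., X_n, Z_n
    with outcomes [o = (x, z)]; the squared norms of the [f o] add up to 1. A
    rejection means that Z_j acts on [f] almost as the sign (-1)^(z_j), with an
    error whose square, summed over [j], is 4n times the rejection probability.
    The other pass yields a family obtained from [f] by a unitary mixing of the
    outcomes, because X_j and Z_j anticommute; undoing the mixing, X_j acts on
    [f] almost as the flip of z_j with the sign (-1)^(x_j). Hence every Pauli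
    operator T acting on the index of [f] is imitated, up to a squared error
    delta = 16 n^2 eps, by an isometry W of H. If [r] is the dimension of the
    span of [f], the coefficients of [f] and of W f lie in one r-dimensional
    space of functions of [o]; so T f is within squared distance delta of that space. On the other
    hand, averaging over all 4^n operators T makes the bits [z] maximally mixed,
    and at most r / 2^n of the squared norm stays in an r-dimensional space.
    Therefore 1 - delta <= r / 2^n. *)

(** * Squared norms *)

Section Norm.
Context {R : realType} {H : hilbertType R}.
Implicit Types u v w : H.
Local Open Scope complex_scope.

Lemma realcM (a b : R) : (a * b)%:C = a%:C * b%:C.
Proof. exact: rmorphM. Qed.

Lemma realcD (a b : R) : (a + b)%:C = a%:C + b%:C.
Proof. exact: rmorphD. Qed.

Lemma realc_nat (k : nat) : (k%:R : R)%:C = k%:R.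
Proof. exact: rmorph_nat. Qed.

Lemma realc_sum (I : Type) (s : seq I) (P : pred I) (F : I -> R) :
  (\sum_(i <- s | P i) F i)%:C = \sum_(i <- s | P i) (F i)%:C.
Proof. exact: rmorph_sum. Qed.

Definition nsq v : R := rnorm v ^+ 2.

Lemma rnormE v : (rnorm v)%:C = `|v|.
Proof. by rewrite /rnorm RRe_real ?normr_real. Qed.

Lemma rnorm_ge0 v : 0 <= rnorm v.
Proof. by rewrite -lecR rnormE normr_ge0. Qed.

Lemma nsqE v : (nsq v)%:C = inner H v v.
Proof. by rewrite innerE -rnormE rmorphXn. Qed.

Lemma nsq_ge0 v : 0 <= nsq v.
Proof. exact: sqr_ge0. Qed.

Lemma nsq_eq0 v : nsq v = 0 -> v = 0.
Proof.
move=> /eqP; rewrite sqrf_eq0 => /eqP n0; apply/eqP.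
by rewrite -normr_eq0 -rnormE n0.
Qed.

Lemma rnormZ (a : R[i]) v : rnorm (a *: v) = complex.Re `|a| * rnorm v.
Proof.
apply: complexI; rewrite rnormE realcM rnormE normrZ RRe_real //.
Qed.

Lemma nsqZ (a : R[i]) v : nsq (a *: v) = complex.Re `|a| ^+ 2 * nsq v.
Proof. by rewrite /nsq rnormZ exprMn. Qed.

Lemma nsqN v : nsq (- v) = nsq v.
Proof. by rewrite /nsq /rnorm normrN. Qed.

Lemma nsq_sign (b : nat) v : nsq ((-1) ^+ b *: v) = nsq v.
Proof. by rewrite nsqZ normrX normrN1 expr1n /= expr1n mul1r. Qed.

Lemma nsq_half v : nsq (2^-1 *: v) = nsq v / 4.
Proof.
rewrite nsqZ gtr0_norm ?invr_gt0 ?ltr0n //.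
have -> : (2^-1 : R[i]) = (2^-1)%:C by rewrite fmorphV rmorph_nat.
rewrite /=; lra.
Qed.

Lemma rnormD u v : rnorm (u + v) <= rnorm u + rnorm v.
Proof. by rewrite -lecR realcD !rnormE ler_normD. Qed.

Lemma rnorm_sum (I : Type) (s : seq I) (P : pred I) (F : I -> H) :
  rnorm (\sum_(i <- s | P i) F i) <= \sum_(i <- s | P i) rnorm (F i).
Proof.
elim/big_rec2: _ => [|i x y _ le_xy]; first by rewrite /rnorm normr0.
by apply: le_trans (rnormD _ _) _; rewrite lerD2l.
Qed.

Lemma parallelogram u v : nsq (u + v) + nsq (u - v) = 2 * (nsq u + nsq v).
Proof.
apply: complexI; rewrite realcM realc_nat !realcD !nsqE.
rewrite !(linearDl, linearDr, linearNl, linearNr) /=; ring.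
Qed.

(** With [t = m + 1], the gap after the triangle inequality is the square [t^-1 * (a - t * b) ^+ 2].
    These weights make the error bounds for words of growing length telescope. *)
Lemma nsq_young (m : nat) u v :
  nsq (u + v) <= (1 + (m.+1)%:R^-1) * nsq u + (1 + (m.+1)%:R) * nsq v.
Proof.
set t := (m.+1)%:R; have t0 : 0 < t :> R by rewrite ltr0n.
have := rnormD u v; have := rnorm_ge0 (u + v).
have := rnorm_ge0 u; have := rnorm_ge0 v.
rewrite /nsq; move: (rnorm _) (rnorm u) (rnorm v) => c a b b0 a0 c0 le_c.
have : c ^+ 2 <= (a + b) ^+ 2 by rewrite ler_sqr // nnegrE addr_ge0.
move/le_trans; apply; rewrite -subr_ge0.
have -> : (1 + t^-1) * a ^+ 2 + (1 + t) * b ^+ 2 - (a + b) ^+ 2 =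
  t^-1 * (a - t * b) ^+ 2 by field; rewrite gt_eqF.
by rewrite mulr_ge0 ?sqr_ge0 // invr_ge0 ltW.
Qed.

End Norm.

(** * Measurements of one qubit *)

Section Measurement.
Context {R : realType} {H : hilbertType R}.
Implicit Types (A B X Z : {linear H -> H}) (u v : H) (b : bool).

Fact meas_vec_is_linear A b : linear (@meas_vec R H A b).
Proof.
move=> a u v; rewrite /meas_vec linearP !scalerDr !scalerA.
rewrite [_ * a]mulrC [_ * _ * a]mulrC mulrA.
by rewrite -!addrA; congr (_ + _); rewrite addrCA.
Qed.

HB.instance Definition _ A b :=
  GRing.isLinear.Build R[i] H H *:%R (@meas_vec R H A b) (meas_vec_is_linear A b).

Lemma reflection_nsq A v : reflection A -> nsq (A v) = nsq v.
Proof. by case=> hA AA; apply: complexI; rewrite !nsqE hA AA. Qed.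

Lemma meas_vec_nsq A b v : nsq (meas_vec A b v) = nsq (v + (-1) ^+ b *: A v) / 4.
Proof. by rewrite /meas_vec nsq_half. Qed.

Lemma meas_vec_total A v :
  reflection A -> \sum_b nsq (meas_vec A b v) = nsq v.
Proof.
move=> rA; rewrite big_bool !meas_vec_nsq /= expr1 expr0 scale1r scaleN1r.
have := parallelogram v (A v); rewrite (reflection_nsq _ rA); lra.
Qed.

(** Up to sign, the vector on the left is twice the component of [v] with the opposite outcome. This
    turns a rejection probability into an operator error. *)
Lemma meas_vec_reject A b v : reflection A ->
  nsq ((-1) ^+ b *: v - A v) = 4 * (nsq v - nsq (meas_vec A b v)).
Proof.
move=> rA; have -> : (-1) ^+ b *: v - A v = (-1) ^+ b *: (v - (-1) ^+ b *: A v).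
  by rewrite scalerBr scalerA -expr2 sqrr_sign scale1r.
rewrite nsq_sign meas_vec_nsq.
have := parallelogram v ((-1) ^+ b *: A v).
rewrite nsq_sign (reflection_nsq _ rA); lra.
Qed.

Lemma meas_vec_sum A v : meas_vec A true v + meas_vec A false v = v.
Proof.
rewrite /meas_vec -scalerDr /= expr1 expr0 scale1r scaleN1r addrACA.
rewrite [- _ + _]addrC subrr addr0 -mulr2n -[v *+ 2]scaler_nat scalerA.
by rewrite mulVf ?scale1r ?pnatr_eq0.
Qed.

Lemma meas_vec_diff A v : meas_vec A false v - meas_vec A true v = A v.
Proof.
rewrite /meas_vec -scalerBr /= expr1 expr0 scale1r scaleN1r opprD opprK addrACA.
by rewrite subrr add0r -mulr2n -[A v *+ 2]scaler_nat scalerA mulVf ?scale1r ?pnatr_eq0.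
Qed.

Lemma meas_vec_eigen A b v :
  reflection A -> A (meas_vec A b v) = (-1) ^+ b *: meas_vec A b v.
Proof.
case=> _ AA; rewrite /meas_vec linearZ linearD linearZ AA !scalerA.
by rewrite [_ ^+ b * _]mulrC -scalerA scalerDr scalerA -expr2 sqrr_sign scale1r addrC.
Qed.

Lemma meas_vec_anticomm X Z b v :
  qubit X Z -> X (meas_vec Z b v) = meas_vec Z (~~ b) (X v).
Proof.
case=> _ _ ac; have XZ : X (Z v) = - Z (X v) by apply/eqP; rewrite -addr_eq0 ac.
rewrite /meas_vec linearZ linearD linearZ XZ; congr (_ *: (_ + _)).
by case: b; rewrite /= ?expr1 ?expr0 ?scaleN1r ?scale1r ?opprK.
Qed.

(* The first outcome of [p] is that of [A], which is measured first. *)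
Definition kraus A B (p : bool * bool) : {linear H -> H} :=
  (@meas_vec R H B p.2 \o @meas_vec R H A p.1).

Lemma sum_bool2 (V : nmodType) (F : bool * bool -> V) :
  \sum_p F p = F (true, true) + F (true, false) + (F (false, true) + F (false, false)).
Proof.
rewrite (eq_bigr (fun p => F (p.1, p.2))) => [|[] //].
by rewrite -(pair_bigA _ (fun a b => F (a, b))) /= !big_bool.
Qed.

(* The entries of a unitary matrix: measuring the two reflections of a qubit
   in either order gives the same channel. *)
Definition mixing (p q : bool * bool) : R[i] :=
  2^-1 * (-1) ^+ ((p.1 (+) q.2) && (p.2 (+) q.1)).

(** Anticommutation moves [X] to the right of the projection of [Z], flipping its outcome. Then [v]
    is the sum, and [X v] the difference, of the two components of [v] under [X]. *)
Lemma kraus_swap X Z p v : qubit X Z ->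
  kraus Z X p v = \sum_q mixing p q *: kraus X Z q v.
Proof.
move=> qXZ; case: p => z x; rewrite sum_bool2 /kraus /mixing /=.
have -> : meas_vec X x (meas_vec Z z v) =
    2^-1 *: (meas_vec Z z v + (-1) ^+ x *: meas_vec Z (~~ z) (X v)).
  by rewrite -meas_vec_anticomm.
rewrite -[X v](meas_vec_diff X v) linearB.
have -> : meas_vec Z z v =
    meas_vec Z z (meas_vec X true v) + meas_vec Z z (meas_vec X false v).
  by rewrite -linearD meas_vec_sum.
rewrite -!scalerA.
case: z; case: x; rewrite /=;
  move: (meas_vec Z true (meas_vec X true v)) (meas_vec Z true (meas_vec X false v))
  (meas_vec Z false (meas_vec X true v)) (meas_vec Z false (meas_vec X false v))
  => a b c d;
  rewrite ?expr1 ?expr0 ?scaleN1r ?scale1r ?opprB -!scalerDr;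
  congr (_ *: _).
- by rewrite addrACA.
- by rewrite [d - c]addrC addrACA.
- by rewrite addrACA [c + a]addrC [- b + d]addrC.
- by rewrite [b - a]addrC addrACA [c - a]addrC [d + b]addrC.
Qed.

Lemma mixing_unitary (y : bool * bool -> H) :
  \sum_p nsq (\sum_q mixing p q *: y q) = \sum_q nsq (y q).
Proof.
have E p : nsq (\sum_q mixing p q *: y q) =
  nsq (\sum_q (-1) ^+ ((p.1 (+) q.2) && (p.2 (+) q.1)) *: y q) / 4.
  by rewrite -nsq_half scaler_sumr; congr nsq; apply: eq_bigr => q _; rewrite scalerA.
under eq_bigr do rewrite E; rewrite -mulr_suml !sum_bool2 /=.
rewrite !expr1 !expr0 !scaleN1r !scale1r.
set a := y (true, true); set b := y (true, false).
set c := y (false, true); set d := y (false, false).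
have -> : - c + d = - (c - d) by rewrite opprB addrC.
have -> : - a + b + (c + d) = - (a - b - (c + d)) by rewrite !opprD !opprK.
rewrite nsqN; have := parallelogram (a + b) (c - d).
have := parallelogram (a - b) (c + d).
have := parallelogram a b; have := parallelogram c d; lra.
Qed.

End Measurement.

(** * Products over the sites *)

Section SiteProducts.
Context {R : realType} {H : hilbertType R} {n : nat}.
Local Notation outcomes := {ffun 'I_n -> bool * bool}.
Local Notation family := ('I_n -> bool * bool -> {linear H -> H}).
Implicit Types (o : outcomes) (K : family) (i j : 'I_n) (p q : bool * bool).
Implicit Types (s : seq 'I_n) (v w : H).

Definition upd o i p : outcomes := [ffun j => if j == i then p else o j].

(** Exchanging [p] with the entry of [o] at [i] is an involution on the pairs [(o, p)]. The lemma
    exposes the sum over the four outcomes of one site. *)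
Lemma sum_upd (V : nmodType) (G : outcomes -> V) i :
  \sum_o \sum_p G (upd o i p) = (\sum_o G o) *+ 4.
Proof.
rewrite pair_bigA /=.
pose h (u : outcomes * (bool * bool)) := (upd u.1 i u.2, u.1 i).
have hK : involutive h.
  case=> o p; rewrite /h /= ffunE eqxx; congr (_, _).
  by apply/ffunP => j; rewrite !ffunE; case: (j =P i) => // ->.
rewrite (reindex_inj (inv_inj hK)) /=.
rewrite (eq_bigr (fun u : outcomes * (bool * bool) => G u.1)); last first.
  move=> u _; congr G; apply/ffunP => j; rewrite !ffunE.
  by case: (j =P i) => // ->.
rewrite -(pair_bigA _ (fun o (p : bool * bool) => G o)) /= -sumrMnl.
by apply: eq_bigr => o _; rewrite sumr_const card_prod card_bool.
Qed.

Definition prodl K s o v : H := foldl (fun w i => K i (o i) w) v s.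

Lemma prodl_comb K s o (I : finType) (a : I -> R[i]) (y : I -> H) :
  prodl K s o (\sum_k a k *: y k) = \sum_k a k *: prodl K s o (y k).
Proof.
elim: s y => //= i s IH y; rewrite -IH linear_sum; congr prodl.
by apply: eq_bigr => k _; rewrite linearZ.
Qed.

Lemma eq_prodl K K' s o o' v :
  (forall i w, i \in s -> K i (o i) w = K' i (o' i) w) ->
  prodl K s o v = prodl K' s o' v.
Proof.
elim: s v => //= i s IH v e; rewrite e ?mem_head //; apply: IH => k w ks.
by rewrite e // inE ks orbT.
Qed.

Lemma prodl_site K K' s o (I : finType) (o' : I -> outcomes) (a : I -> R[i]) i v :
  uniq s -> i \in s ->
  (forall w, K' i (o i) w = \sum_k a k *: K i (o' k i) w) ->
  (forall k j w, j != i -> K' j (o j) w = K j (o' k j) w) ->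
  prodl K' s o v = \sum_k a k *: prodl K s (o' k) v.
Proof.
move=> us is_ Ki Kj; case/splitPr: is_ us => s1 s2.
rewrite cat_uniq /= negb_or => /and3P[_ /andP[n1 _] /andP[n2 _]].
rewrite /prodl foldl_cat /= -!/(prodl _ _ _ _) Ki prodl_comb.
apply: eq_bigr => k _; rewrite foldl_cat /= -!/(prodl _ _ _ _); congr (_ *: _).
rewrite -(@eq_prodl K' K s2 o (o' k)); last first.
  by move=> j w js; apply: Kj; apply: contraNneq n2 => <-.
rewrite -(@eq_prodl K' K s1 o (o' k)) //.
by move=> j w js; apply: Kj; apply: contraNneq n1 => <-.
Qed.

(** The last operator is summed out by completeness. A site outside [s] does not affect the product
    but its four outcomes are still counted; the powers of 4 record this without subtraction. *)
Lemma prodl_nsq K s v : uniq s ->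
  (forall i w, \sum_p nsq (K i p w) = nsq w) ->
  (\sum_o nsq (prodl K s o v)) * 4 ^+ size s = 4 ^+ n * nsq v.
Proof.
move=> us hK; elim/last_ind: s us => [|s i IH].
  move=> _; rewrite /= sumr_const card_ffun card_prod card_bool card_ord.
  by rewrite expr0 mulr1 -[_ *+ _]mulr_natl natrX.
rewrite rcons_uniq => /andP[nis us].
rewrite -(IH us) size_rcons exprS mulrA; congr (_ * _).
rewrite mulr_natr -(sum_upd _ i); apply: eq_bigr => o _.
rewrite -(hK i); apply: eq_bigr => p _.
rewrite /prodl foldl_rcons ffunE eqxx -!/(prodl _ _ _ _).
rewrite (@eq_prodl K K s _ o) // => j w js; rewrite ffunE.
by case: eqP => // ji; move: nis; rewrite -ji js.
Qed.

Definition hybrid K K' k : family := fun i => if (i < k)%N then K' i else K i.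

(* Replacing the sites one at a time; each replacement is a unitary mixing of
   the four outcomes of that site. *)
Lemma sum_nsq_mixing (X : {linear H -> H}) (K1 K1' K2 K2' : family) s v :
  uniq s -> (forall i, i \in s) ->
  (forall i p w, K1' i p w = \sum_q mixing p q *: K1 i q w) ->
  (forall i p w, K2' i p w = \sum_q mixing p q *: K2 i q w) ->
  \sum_o nsq (X (prodl K1' s o v) - prodl K2' s o v) =
  \sum_o nsq (X (prodl K1 s o v) - prodl K2 s o v).
Proof.
move=> us sT m1 m2.
pose S k := \sum_o nsq (X (prodl (hybrid K1 K1' k) s o v) -
                        prodl (hybrid K2 K2' k) s o v).
have S0 : S 0%N = \sum_o nsq (X (prodl K1 s o v) - prodl K2 s o v).
  by apply: eq_bigr => o _; congr (nsq (X _ - _)); apply: eq_prodl.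
have Sn : S n = \sum_o nsq (X (prodl K1' s o v) - prodl K2' s o v).
  by apply: eq_bigr => o _; congr (nsq (X _ - _)); apply: eq_prodl => i w _;
    rewrite /hybrid ltn_ord.
rewrite -S0 -Sn; suff SE k : (k <= n)%N -> S k = S 0%N by rewrite SE.
elim: k => // k IH lt_kn; rewrite -{}IH 1?ltnW //.
pose i := Ordinal lt_kn.
(* The factor 4 makes the sum over the outcomes [p] of site [i] explicit; there the new vectors are
   the [mixing] of the old ones. *)
apply: (@mulIf _ 4); rewrite ?pnatr_eq0 // !mulr_natr -!(sum_upd _ i).
apply: eq_bigr => o _; rewrite -[RHS]mixing_unitary; apply: eq_bigr => p _; congr nsq.
have site (K K' : family) : (forall i p w, K' i p w = \sum_q mixing p q *: K i q w) ->
    prodl (hybrid K K' k.+1) s (upd o i p) v =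
    \sum_q mixing p q *: prodl (hybrid K K' k) s (upd o i q) v.
  move=> m; apply: (@prodl_site _ _ _ _ _ _ _ i) => // [w|q j w ji].
    rewrite ffunE eqxx /hybrid ltnSn ltnn m.
    by apply: eq_bigr => q _; rewrite ffunE eqxx.
  rewrite !ffunE (negPf ji) /hybrid ltnS leq_eqVlt.
  by have -> : (j == k :> nat) = false by apply: contraNF ji => /eqP e; apply/eqP/val_inj.
rewrite !site // linear_sum -sumrB; apply: eq_bigr => q _.
by rewrite linearZ scalerBr.
Qed.

End SiteProducts.

(** * Rejection probabilities *)

Section Acceptance.
Context {R : realType} {H : hilbertType R}.

Lemma nsq0 : nsq (0 : H) = 0 :> R.
Proof. by rewrite -(scale0r (0 : H)) nsqZ normr0 expr0n mul0r. Qed.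

(** The probability is exactly the squared normalization factor that [meas_post] divides out. For an
    outcome of probability 0 both sides vanish, whatever the default value. *)
Lemma meas_prob_post (A : {linear H -> H}) (b : bool) (F : {linear H -> H}) v :
  meas_prob A b v * nsq (F (meas_post A b v)) = nsq (F (meas_vec A b v)).
Proof.
rewrite /meas_prob /meas_post linearZ nsqZ; set w := meas_vec A b v.
have [w0|w0] := eqVneq (rnorm w) 0.
  have -> : w = 0 by apply: nsq_eq0; rewrite /nsq w0 expr0n.
  by rewrite linear0 nsq0 !mulr0.
rewrite mulrA -exprMn normfV normr_id -rnormE -fmorphV /= divff //.
by rewrite expr1n mul1r.
Qed.

Context {n : nat}.
Local Notation outcomes := {ffun 'I_n -> bool * bool}.
Local Notation family := ('I_n -> bool * bool -> {linear H -> H}).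
Implicit Types (A B X Z : 'I_n -> {linear H -> H}).
Implicit Types (o : {ffun 'I_n -> bool * bool}) (v : H).

Definition krausF A B (i : 'I_n) p := kraus (A i) (B i) p.

Lemma pass_prob A B o (L : {linear H -> H}) v :
  seq_prob (pass A B o) v * nsq (L (seq_post (pass A B o) v)) =
  nsq (L (prodl (krausF A B) (enum 'I_n) o v)).
Proof.
rewrite /pass; elim: (enum _) v => [|i s IH] v /=; first by rewrite mul1r.
set t := flatten _; rewrite -mulrA -[X in _ * X]mulrA IH.
pose F := L \o prodl (krausF A B) s o.
have linF : linear F.
  move=> a u w; rewrite /F /=.
  have -> : a *: u + w = \sum_(k : bool) (if k then a else 1) *: (if k then u else w).
    by rewrite big_bool /= scale1r.
  by rewrite prodl_comb big_bool /= scale1r linearP.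
pose F' : {linear H -> H} := HB.pack F (GRing.isLinear.Build _ _ _ _ F linF).
have e u b : meas_prob (B i) b u *
    nsq (L (prodl (krausF A B) s o (meas_post (B i) b u))) =
    nsq (L (prodl (krausF A B) s o (meas_vec (B i) b u))) := meas_prob_post _ _ F' _.
rewrite e.
exact: (meas_prob_post (A i) (o i).1 (F' \o @meas_vec R H (B i) (o i).2)).
Qed.

Lemma accept_prob_orderE A B v :
  accept_prob_order A B v = n%:R^-1 * \sum_j \sum_(o : outcomes)
    nsq (meas_vec (B j) (o j).2 (prodl (krausF A B) (enum 'I_n) o v)).
Proof.
rewrite /accept_prob_order exchange_big mulr_sumr; apply: eq_bigr => o _.
rewrite mulrCA; congr (_ * _); rewrite mulr_sumr; apply: eq_bigr => j _.
exact: pass_prob.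
Qed.

Lemma kraus_total A B i v : reflection (A i) -> reflection (B i) ->
  \sum_p nsq (krausF A B i p v) = nsq v.
Proof.
move=> rA rB; rewrite (eq_bigr (fun p =>
  nsq (meas_vec (B i) p.2 (meas_vec (A i) p.1 v)))) //.
rewrite -(pair_bigA _ (fun a b => nsq (meas_vec (B i) b (meas_vec (A i) a v)))) /=.
by under eq_bigr do rewrite meas_vec_total //; rewrite meas_vec_total.
Qed.

Lemma pass_total A B v : (forall i, reflection (A i)) -> (forall i, reflection (B i)) ->
  \sum_(o : outcomes) nsq (prodl (krausF A B) (enum 'I_n) o v) = nsq v.
Proof.
move=> rA rB; have := @prodl_nsq _ _ _ (krausF A B) (enum 'I_n) v (enum_uniq _).
rewrite size_enum_ord mulrC => h; apply: (mulfI _ (h _)).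
  by rewrite expf_neq0 // pnatr_eq0.
by move=> i w; apply: kraus_total.
Qed.

Lemma reject_sum A B v : (0 < n)%N ->
  (forall i, reflection (A i)) -> (forall i, reflection (B i)) -> nsq v = 1 ->
  \sum_j \sum_(o : outcomes)
    nsq ((-1) ^+ (o j).2 *: prodl (krausF A B) (enum 'I_n) o v -
         B j (prodl (krausF A B) (enum 'I_n) o v)) =
  4 * n%:R * (1 - accept_prob_order A B v).
Proof.
move=> n0 rA rB v1; rewrite accept_prob_orderE.
under eq_bigr => j _.
  under eq_bigr => o _ do rewrite meas_vec_reject //.
  rewrite -mulr_sumr sumrB pass_total // v1.
  over.
rewrite -mulr_sumr sumrB sumr_const card_ord -mulrA; congr (_ * _).
by rewrite mulrBr mulr1 mulrA divff ?mul1r // pnatr_eq0 -lt0n.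
Qed.

Definition flip (o : {ffun 'I_n -> bool * bool}) j := upd o j ((o j).1, ~~ (o j).2).

(** The rejection error of the order Z, X is rewritten without outcome-dependent signs, so that the
    unitary mixing of outcomes carries it to the order X, Z. *)
Lemma reject_sum_swap X Z v : (0 < n)%N ->
  (forall i, qubit (X i) (Z i)) -> nsq v = 1 ->
  \sum_j \sum_(o : outcomes)
    nsq ((-1) ^+ (o j).1 *: prodl (krausF X Z) (enum 'I_n) (flip o j) v -
         X j (prodl (krausF X Z) (enum 'I_n) o v)) =
  4 * n%:R * (1 - accept_prob_order Z X v).
Proof.
move=> n0 q v1; rewrite -reject_sum //; try by move=> i; case: (q i).
apply: eq_bigr => j _.
(* [ext K] inserts [X j] right after the operator of site [j], before the later sites. The error
   compares this with [X j] applied at the very end. *)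
pose ext (K : family) i p : {linear H -> H} :=
  if i == j then (X j \o K i p : {linear H -> H}) else K i p.
have extE (K K' : family) : (forall i p w, K' i p w = \sum_q mixing p q *: K i q w) ->
    forall i p w, ext K' i p w = \sum_q mixing p q *: ext K i q w.
  move=> m i p w; rewrite /ext; case: eqP => // _ /=; rewrite m linear_sum.
  by apply: eq_bigr => r _; rewrite linearZ.
have site (K K' : family) o o' (a : R[i]) :
    (forall w, K' j (o j) w = a *: K j (o' j) w) ->
    (forall i w, i != j -> K' i (o i) w = K i (o' i) w) ->
    prodl K' (enum 'I_n) o v = a *: prodl K (enum 'I_n) o' v.
  move=> e1 e2.
  rewrite (@prodl_site _ _ _ K K' _ o 'I_1 (fun=> o') (fun=> a) j) ?big_ord1
    ?enum_uniq ?mem_enum //.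
  by move=> w; rewrite big_ord1.
have mix i p w : krausF Z X i p w = \sum_r mixing p r *: krausF X Z i r w.
  exact: kraus_swap.
have E := @sum_nsq_mixing _ _ _ (X j) _ _ _ _ (enum 'I_n) v (enum_uniq _)
  (mem_enum 'I_n) mix (extE (krausF X Z) (krausF Z X) mix).
(* In the order X, Z the inserted [X j] crosses the projection of [Z j], flipping its outcome, and
   becomes a sign on the projection of [X j]. In the order Z, X it meets its own projection at once
   and is just a sign. *)
transitivity (\sum_(o : outcomes) nsq (X j (prodl (krausF X Z) (enum 'I_n) o v) -
                          prodl (ext (krausF X Z)) (enum 'I_n) o v)).
  apply: eq_bigr => o _; rewrite -nsqN opprB; congr (nsq (_ - _)); apply/esym/site.
    move=> w; rewrite /ext eqxx /flip ffunE eqxx /krausF /kraus /=.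
    rewrite meas_vec_anticomm // meas_vec_eigen; last by case: (q j).
    exact: linearZ.
  by move=> i w ij; rewrite /ext (negPf ij) /flip ffunE (negPf ij).
rewrite -E; apply: eq_bigr => o _; rewrite -nsqN opprB; congr (nsq (_ - _)).
apply: site => [w|i w ij]; last by rewrite /ext (negPf ij).
rewrite /ext eqxx /krausF /kraus /= meas_vec_eigen //.
by case: (q j).
Qed.

End Acceptance.

(** * Orthonormal frames *)

Section Frames.
Context {R : realType} {H : hilbertType R} {I : finType}.
Implicit Types (f g : I -> H).

Lemma inner_suml (J : finType) (P : pred J) (F : J -> H) v :
  inner H (\sum_(k | P k) F k) v = \sum_(k | P k) inner H (F k) v.
Proof. exact: linear_sumlz. Qed.

Lemma inner_sumr (J : finType) (P : pred J) (F : J -> H) v :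
  inner H v (\sum_(k | P k) F k) = \sum_(k | P k) inner H v (F k).
Proof. exact: linear_sum. Qed.

Lemma innerZl (a : R[i]) (u v : H) : inner H (a *: u) v = a * inner H u v.
Proof. exact: linearZl_LR. Qed.

Lemma innerZr (a : R[i]) (u v : H) : inner H u (a *: v) = a^* * inner H u v.
Proof. exact: linearZr_LR. Qed.

Lemma innerBl (u v w : H) : inner H (u - v) w = inner H u w - inner H v w.
Proof. exact: linearBl. Qed.

Lemma innerBr (u v w : H) : inner H w (u - v) = inner H w u - inner H w v.
Proof. exact: linearB. Qed.

Lemma inner_eq0 (v : H) : inner H v v = 0 -> v = 0.
Proof. by rewrite innerE => /eqP; rewrite sqrf_eq0 normr_eq0 => /eqP. Qed.

(* The rank of the Gram matrix of [f] is the dimension of its span. *)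
Lemma indep_subfamily f : exists r (e : 'I_r -> H) (a : I -> 'I_r -> R[i]),
  [/\ (r <= #|I|)%N, lin_indep e & forall i, f i = \sum_k a i k *: e k].
Proof.
pose G : 'M[R[i]]_#|I| := \matrix_(i, j) inner H (f (enum_val i)) (f (enum_val j)).
pose g := maxrankfun G; pose e k := f (enum_val (g k)).
exists (\rank G), e.
have /submxP[D GD] : (G <= rowsub g G)%MS by rewrite eq_maxrowsub.
exists (fun i k => D (enum_rank i) k); split; first exact: rank_leq_row.
  move=> c c0 k.
  have : (\row_k c k) *m rowsub g G = 0.
    apply/rowP => j; rewrite !mxE.
    transitivity (inner H (\sum_k c k *: e k) (f (enum_val j))).
      by rewrite inner_suml; apply: eq_bigr => l _; rewrite innerZl !mxE.
    by rewrite c0 linear0l.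
  move/eqP; rewrite mulmx_free_eq0 ?maxrowsub_free // => /eqP /rowP /(_ k).
  by rewrite !mxE.
move=> i; apply/eqP; rewrite -subr_eq0; apply/eqP.
(* Since [D] reproduces the rows of the Gram matrix, the defect [w] is orthogonal to every [f j]. It
   is itself a combination of these vectors, hence orthogonal to itself. *)
set w := _ - _.
have wf j : inner H w (f j) = 0.
  rewrite /w innerBl inner_suml.
  have /matrixP/(_ (enum_rank i) (enum_rank j)) := GD.
  rewrite !mxE !enum_rankK => ->; apply/eqP; rewrite subr_eq0; apply/eqP.
  by apply: eq_bigr => k _; rewrite innerZl !mxE enum_rankK.
apply: inner_eq0; rewrite {2}/w innerBr wf inner_sumr sub0r big1 ?oppr0 // => k _.
by rewrite innerZr wf mulr0.
Qed.

(** Gram-Schmidt is applied to the coefficient functions on [I], not to vectors of [H]. A linear map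
    applied to all [f i] then changes only the [h k] and keeps the frame [u]. *)
Lemma orthonormal_frame f : exists r (u : 'I_r -> I -> R[i]) (h : 'I_r -> H),
  [/\ exists e : 'I_r -> H, lin_indep e,
      forall k l, \sum_i (u k i)^* * u l i = (k == l)%:R &
      forall i, f i = \sum_k u k i *: h k].
Proof.
have [r [e [a [le_r ie fE]]]] := indep_subfamily f.
pose A : 'M[R[i]]_(r, #|I|) := \matrix_(k, i) a (enum_val i) k.
pose U := schmidt A.
have /submxP[D AD] := schmidt_sub A.
exists r, (fun k i => U k (enum_rank i)), (fun l => \sum_k D k l *: e k).
split; first by exists e.
  move=> k l; have /unitarymxP/matrixP/(_ l k) := schmidt_unitarymx A le_r.
  rewrite !mxE eq_sym => <-; rewrite (reindex_onto enum_val enum_rank); last first.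
    by move=> i _; rewrite enum_rankK.
  apply: eq_big => [i|i _]; first by rewrite enum_valK eqxx.
  by rewrite enum_valK !mxE mulrC.
move=> i; rewrite fE.
under [RHS]eq_bigr do rewrite scaler_sumr.
rewrite exchange_big /=; apply: eq_bigr => k _.
under eq_bigr do rewrite scalerA.
rewrite -scaler_suml; congr (_ *: _).
have /matrixP/(_ k (enum_rank i)) := AD; rewrite !mxE enum_rankK => ->.
by apply: eq_bigr => l _; rewrite mulrC.
Qed.

(** Pythagoras for [H]-valued functions: with [p k] the coefficient of [g] along [u k], the two
    sides differ by the sum of the squared norms of [p k - h k]. *)
Lemma bessel r (u : 'I_r -> I -> R[i]) (h : 'I_r -> H) g :
  (forall k l, \sum_i (u k i)^* * u l i = (k == l)%:R) ->
  \sum_i nsq (g i) - \sum_k nsq (\sum_i (u k i)^* *: g i) <=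
  \sum_i nsq (g i - \sum_k u k i *: h k).
Proof.
move=> ou; pose p k := \sum_i (u k i)^* *: g i.
suff -> : \sum_i nsq (g i - \sum_k u k i *: h k) =
    \sum_i nsq (g i) - \sum_k nsq (p k) + \sum_k nsq (p k - h k).
  by rewrite lerDl sumr_ge0 // => k _; exact: nsq_ge0.
rewrite -addrA -sumrN -big_split /=.
have E1 i : nsq (g i - \sum_k u k i *: h k) = nsq (g i) +
    (nsq (g i - \sum_k u k i *: h k) - nsq (g i)) by ring.
under eq_bigr do rewrite E1.
rewrite big_split /=; congr (_ + _); apply: complexI; rewrite !realc_sum.
pose X := \sum_k inner H (p k) (h k); pose Y := \sum_k inner H (h k) (p k).
pose Q := \sum_k inner H (h k) (h k).
transitivity (Q - X - Y).
  have E2 i : ((nsq (g i - \sum_k u k i *: h k) - nsq (g i))%:C)%C =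
     inner H (\sum_k u k i *: h k) (\sum_k u k i *: h k)
     - inner H (g i) (\sum_k u k i *: h k) - inner H (\sum_k u k i *: h k) (g i).
    rewrite realcD -[(- _)%:C%C]/(real_complex R (- _)) rmorphN /= !nsqE.
    rewrite !(innerBl, innerBr); ring.
  under eq_bigr do rewrite E2.
  rewrite !sumrB; congr (_ - _ - _).
  - under eq_bigr => i _.
      rewrite inner_suml.
      under eq_bigr => k _.
        rewrite innerZl inner_sumr mulr_sumr.
        under eq_bigr do rewrite innerZr mulrA.
        over.
      over.
    rewrite exchange_big; apply: eq_bigr => k _; rewrite exchange_big /=.
    rewrite (bigD1 k) //= [X in _ + X]big1 ?addr0 => [|l lk].
      rewrite -mulr_suml -[RHS]mul1r; congr (_ * _).
      transitivity ((k == k)%:R : R[i]); last by rewrite eqxx.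
      by rewrite -ou; apply: eq_bigr => i _; rewrite mulrC.
    transitivity ((l == k)%:R * inner H (h k) (h l)); last by rewrite (negPf lk) mul0r.
    rewrite -mulr_suml -ou; congr (_ * _).
    by apply: eq_bigr => i _; rewrite mulrC.
  - under eq_bigr do rewrite inner_sumr.
    rewrite exchange_big; apply: eq_bigr => k _; rewrite inner_suml.
    by apply: eq_bigr => i _; rewrite innerZl innerZr.
  - under eq_bigr do rewrite inner_suml.
    rewrite exchange_big; apply: eq_bigr => k _; rewrite inner_sumr.
    by apply: eq_bigr => i _; rewrite innerZl innerZr conjCK.
rewrite /Q /X /Y -!sumrB; apply: eq_bigr => k _.
rewrite realcD -[(- _)%:C%C]/(real_complex R (- _)) rmorphN /= !nsqE.
rewrite !(innerBl, innerBr); ring.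
Qed.

Lemma cauchy_sum (P : pred I) (p q : I -> R) :
  (\sum_(i | P i) p i * q i) ^+ 2 <=
  (\sum_(i | P i) p i ^+ 2) * (\sum_(i | P i) q i ^+ 2).
Proof.
(* Lagrange's identity: this double sum is twice the gap in the inequality. *)
have : 0 <= \sum_(i | P i) \sum_(j | P j) (p i * q j - p j * q i) ^+ 2.
  by apply: sumr_ge0 => i _; apply: sumr_ge0 => j _; exact: sqr_ge0.
under eq_bigr => i _.
  under eq_bigr => j _.
    have -> : (p i * q j - p j * q i) ^+ 2 =
      p i ^+ 2 * q j ^+ 2 + q i ^+ 2 * p j ^+ 2 - 2 * (p i * q i) * (p j * q j) by ring.
    over.
  rewrite sumrB big_split /= -!mulr_sumr.
  over.
rewrite sumrB big_split /= -!mulr_suml -mulr_sumr.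
set a := \sum_(i | P i) p i ^+ 2; set b := \sum_(i | P i) q i ^+ 2.
set c := \sum_(i | P i) p i * q i; nra.
Qed.

Lemma nsq_cauchy (P : pred I) (a : I -> R[i]) g :
  nsq (\sum_(i | P i) a i *: g i) <=
  (\sum_(i | P i) complex.Re `|a i| ^+ 2) * (\sum_(i | P i) nsq (g i)).
Proof.
apply: le_trans (cauchy_sum _ _ _).
have := rnorm_sum (index_enum I) P (fun i => a i *: g i).
under [leRHS]eq_bigr do rewrite rnormZ.
by move=> le_s; rewrite /nsq ler_sqr // nnegrE ?(le_trans _ le_s) ?rnorm_ge0.
Qed.

End Frames.

(** * Twirling and words of operators *)

Section Twirl.
Context {R : realType} {H : hilbertType R} {n : nat}.
Local Notation outcomes := {ffun 'I_n -> bool * bool}.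
Local Notation bits := {ffun 'I_n -> bool}.
Implicit Types (c d z : bits) (o : outcomes) (f : outcomes -> H).

(** The characters of the group of bit strings, that is, the diagonal entries of the products of
    Pauli Z operators. *)
Definition chi d z : R[i] := \prod_i (-1) ^+ (d i && z i).

Definition shift_second c o : outcomes := [ffun i => ((o i).1, (o i).2 (+) c i)].

Definition second o : bits := [ffun i => (o i).2].

Lemma chi_conj d z : (chi d z)^* = chi d z.
Proof. by rewrite rmorph_prod; apply: eq_bigr => i _; rewrite rmorphXn rmorphN1. Qed.

Lemma chi_orth z z' : \sum_d chi d z * chi d z' = 2 ^+ n * (z == z')%:R.
Proof.
under eq_bigr do rewrite /chi -big_split /=.
rewrite -(bigA_distr_bigA (fun i b => (-1) ^+ (b && z i) * (-1) ^+ (b && z' i) : R[i])).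
under eq_bigr do rewrite big_bool /= mulr1.
case: (z =P z') => [e|/eqP ne].
  rewrite -e.
  under eq_bigr do rewrite -expr2 sqrr_sign.
  by rewrite prodr_const card_ord mulr1.
have /existsP[i zi] : [exists i, z i != z' i].
  by apply: contraNT ne => /existsPn e; apply/eqP/ffunP => i; apply/eqP/negPn/e.
rewrite mulr0 (bigD1 i) //=; move: zi; case: (z i); case: (z' i) => // _;
  by rewrite /= expr1 expr0 ?mulr1 ?mul1r addNr mul0r.
Qed.

Lemma parseval (G : bits -> H) :
  \sum_d nsq (\sum_z chi d z *: G z) = 2 ^+ n * \sum_z nsq (G z).
Proof.
apply: complexI; rewrite realcM !realc_sum.
have -> : (((2 : R) ^+ n)%:C)%C = 2 ^+ n by rewrite rmorphXn /= realc_nat.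
transitivity (\sum_d \sum_z \sum_z' chi d z * chi d z' * inner H (G z) (G z')).
  apply: eq_bigr => d _; rewrite nsqE inner_suml; apply: eq_bigr => z _.
  rewrite innerZl inner_sumr mulr_sumr; apply: eq_bigr => z' _.
  by rewrite innerZr chi_conj mulrA.
rewrite exchange_big mulr_sumr; apply: eq_bigr => z _; rewrite exchange_big /=.
rewrite (bigD1 z) //= [X in _ + X]big1 ?addr0 => [|z' zz].
  by rewrite -mulr_suml chi_orth eqxx mulr1 nsqE.
by rewrite -mulr_suml chi_orth eq_sym (negPf zz) mulr0 mul0r.
Qed.

Lemma shift_secondK c : involutive (shift_second c).
Proof.
move=> o; apply/ffunP => i; rewrite !ffunE /= -addbA addbb addbF.
by case: (o i).
Qed.

(* Averaged over the Pauli group acting on the second bits of the outcomes,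
   every vector becomes maximally mixed there, so no unit vector [u] overlaps
   the average by more than [2 ^- n]. *)
Lemma twirl_bound (u : outcomes -> R[i]) (xi : bits -> outcomes -> R[i]) f :
  (forall c o, complex.Re `|xi c o| = 1) ->
  \sum_c \sum_d nsq (\sum_o u o *: (chi d (second o) *: (xi c o *: f (shift_second c o))))
  <= 2 ^+ n * (\sum_o complex.Re `|u o| ^+ 2) * \sum_o nsq (f o).
Proof.
move=> xi1.
(* For fixed [c], Parseval over [d] decouples the fibers of [second]; [A z] and [B c z] are the
   Cauchy-Schwarz factors on the fiber over [z]. *)
pose A z := \sum_(o | second o == z) complex.Re `|u o| ^+ 2.
pose B c z := \sum_(o | second o == z) nsq (f (shift_second c o)).
apply: (@le_trans _ _ (\sum_c 2 ^+ n * \sum_z A z * B c z)).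
  apply: ler_sum => c _.
  rewrite (eq_bigr (fun d => nsq (\sum_z chi d z *:
      \sum_(o | second o == z) (u o * xi c o) *: f (shift_second c o)))); last first.
    move=> d _; congr nsq; rewrite (partition_big second predT) //=.
    apply: eq_bigr => z _; rewrite scaler_sumr; apply: eq_bigr => o /eqP <-.
    by rewrite !scalerA mulrCA mulrA.
  rewrite parseval ler_wpM2l ?exprn_ge0 //; apply: ler_sum => z _.
  apply: le_trans (nsq_cauchy _ _ _) _; apply: ler_wpM2r.
    by apply: sumr_ge0 => o _; exact: nsq_ge0.
  rewrite le_eqVlt; apply/orP; left; apply/eqP; apply: eq_bigr => o _.
  have xiC : `|xi c o| = 1 by rewrite -[LHS]RRe_real ?normr_real // xi1.
  by rewrite normrM xiC mulr1.
rewrite -mulr_sumr exchange_big -mulrA ler_wpM2l ?exprn_ge0 //=.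
(* Exactly one shift [c] brings a given outcome into the fiber over [z]. *)
have Bsum z : \sum_c B c z = \sum_o nsq (f o).
  rewrite [RHS](partition_big (fun o => [ffun i => z i (+) (o i).2] : bits) predT) //=.
  apply: eq_bigr => c _; rewrite /B (reindex_inj (inv_inj (shift_secondK c))) /=.
  apply: eq_big => [ o|o _]; last by rewrite shift_secondK.
  apply/eqP/eqP => <-; apply/ffunP => i; rewrite !ffunE /=;
    by [rewrite addbC addbA addbb addFb | rewrite addbC -addbA addbb addbF].
under eq_bigr do rewrite -mulr_sumr Bsum.
by rewrite -mulr_suml [X in _ <= X * _](partition_big second predT).
Qed.

End Twirl.

(** * Signed permutations of the index imitated by isometries of the space *)

Section Words.
Context {R : realType} {H : hilbertType R} {I : finType} {J : Type}.
Variables (sgn : J -> I -> bool) (perm : J -> I -> I) (W : J -> {linear H -> H}).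
Hypothesis perm_inj : forall t, injective (perm t).
Hypothesis W_nsq : forall t v, nsq (W t v) = nsq v.
Implicit Types (s : seq J) (f g : I -> H).

Definition act t g i : H := (-1) ^+ sgn t i *: g (perm t i).

Definition word s (v : H) : H := foldl (fun w t => W t w) v s.

Fact word_is_linear s : linear (word s).
Proof. by elim: s => [|t s IH] a u v //=; rewrite /word /= linearP; exact: IH. Qed.

HB.instance Definition _ s :=
  GRing.isLinear.Build R[i] H H *:%R (word s) (word_is_linear s).

Lemma word_nsq s v : nsq (word s v) = nsq v.
Proof. by elim: s v => //= t s IH v; rewrite IH W_nsq. Qed.

Lemma act_nsq t g : \sum_i nsq (act t g i) = \sum_i nsq (g i).
Proof.
rewrite [RHS](reindex_inj (@perm_inj t)).
by apply: eq_bigr => i _; rewrite /act nsq_sign.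
Qed.

Lemma foldr_act_nsq s f : \sum_i nsq (foldr act f s i) = \sum_i nsq (f i).
Proof. by elim: s => //= t s <-; rewrite act_nsq. Qed.

(** Operators on the index commute with linear maps of [H], so the letters of [word] compose in the
    order opposite to that of [foldr act]. A new letter adds an error [D] to the old error [E],
    which [act] only permutes up to sign. *)
Lemma approx_word s f :
  \sum_i nsq (foldr act f s i - word s (f i)) <=
  (size s)%:R * \sum_(t <- s) \sum_i nsq (act t f i - W t (f i)).
Proof.
elim: s => [|t s IH] /=.
  by rewrite mul0r big1 // => i _; rewrite subrr nsq0.
pose E i := act t (fun i => foldr act f s i - word s (f i)) i.
pose D i := word s (act t f i - W t (f i)).
have split_i i : act t (foldr act f s) i - word s (W t (f i)) = E i + D i.
  have -> : D i = word s (act t f i) - word s (W t (f i)) by exact: linearB.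
  have -> : word s (act t f i) = (-1) ^+ sgn t i *: word s (f (perm t i)).
    exact: linearZ.
  by rewrite /E /act scalerBr addrA subrK.
rewrite (eq_bigr (fun i => nsq (E i + D i))); last by move=> i _; rewrite -split_i.
rewrite big_cons; set e := \sum_i nsq (act t f i - W t (f i)).
have DE : \sum_i nsq (D i) = e by apply: eq_bigr => i _; rewrite word_nsq.
have EE : \sum_i nsq (E i) = \sum_i nsq (foldr act f s i - word s (f i)).
  exact: act_nsq.
have e0 : 0 <= e by apply: sumr_ge0 => i _; exact: nsq_ge0.
set S := \sum_(j <- s) _ in IH *.
(* The weight in [nsq_young] is the length of [s], which must be positive; for a one-letter word [E]
   vanishes. *)
case ss : (size s) IH => [|m] IH.
  have E0 i : E i = 0.
    by rewrite /E /act (size0nil ss) /= subrr scaler0.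
  have S0 : S = 0 by rewrite /S (size0nil ss) big_nil.
  rewrite S0 addr0 mul1r -DE; apply: ler_sum => i _.
  by rewrite E0 add0r.
apply: (@le_trans _ _ (\sum_i ((1 + (m.+1)%:R^-1) * nsq (E i) +
                               (1 + (m.+1)%:R) * nsq (D i)))).
  by apply: ler_sum => i _; exact: nsq_young.
rewrite big_split /= -!mulr_sumr DE EE.
have -> : (m.+2)%:R = 1 + (m.+1)%:R :> R by rewrite -natr1 addrC.
rewrite mulrDr addrC lerD2l.
apply: (@le_trans _ _ ((1 + m.+1%:R^-1) * (m.+1%:R * S))).
  by rewrite ler_wpM2l // addr_ge0 // invr_ge0.
by rewrite mulrA mulrDl mul1r mulVf ?pnatr_eq0 // addrC.
Qed.

End Words.

(** * The dimension bound *)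

Section Dimension.
Context {R : realType} {H : hilbertType R} {n : nat}.
Local Notation outcomes := {ffun 'I_n -> bool * bool}.
Local Notation bits := {ffun 'I_n -> bool}.
Implicit Types (c d : bits) (o : outcomes) (f : outcomes -> H).
Variables (X Z : 'I_n -> {linear H -> H}).
Hypothesis XZ : forall j, qubit (X j) (Z j).

Lemma flipK j : involutive (fun o => flip o j).
Proof.
move=> o; apply/ffunP => i; rewrite !ffunE eqxx /=.
by case: (i =P j) => // ->; rewrite negbK; case: (o j).
Qed.

(* The letter [(true, j)] stands for [Z j], and [(false, j)] for [X j]. *)
Definition letter_sgn (t : bool * 'I_n) o : bool :=
  if t.1 then (o t.2).2 else (o t.2).1.

Definition letter_perm (t : bool * 'I_n) o : outcomes :=
  if t.1 then o else flip o t.2.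

Definition letter_op (t : bool * 'I_n) : {linear H -> H} :=
  if t.1 then Z t.2 else X t.2.

Lemma letter_perm_inj t : injective (letter_perm t).
Proof. by case: t => [[] j] //; exact: inv_inj (flipK j). Qed.

Lemma letter_op_nsq t v : nsq (letter_op t v) = nsq v.
Proof. by case: t => [[] j]; apply: reflection_nsq; case: (XZ j). Qed.

Local Notation act := (@act R H _ _ letter_sgn letter_perm).

Definition pauli_word c d : seq (bool * 'I_n) :=
  [seq (true, j) | j <- enum 'I_n & d j] ++ [seq (false, j) | j <- enum 'I_n & c j].

(** Flips change only second bits while the signs read only first bits, so the letters do not
    interfere. *)
Lemma foldr_act_X (s : seq 'I_n) f o : uniq s ->
  foldr act f [seq (false, j) | j <- s] o =
  \prod_(j <- s) (-1) ^+ (o j).1 *: f (shift_second [ffun i => i \in s] o).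
Proof.
elim: s o => [|j s IH] o.
  move=> _; rewrite big_nil scale1r /=; congr f; apply/ffunP => i.
  by rewrite !ffunE in_nil addbF; case: (o i).
move=> /= /andP[js us]; rewrite {1}/act IH //.
rewrite /letter_sgn /letter_perm /= scalerA big_cons; congr (_ * _ *: f _).
  apply: eq_bigr => i _; rewrite /flip ffunE.
  by case: (i =P j) => [->|].
apply/ffunP => i; rewrite !ffunE inE.
by case: (i =P j) => [->|] //=; rewrite (negPf js) addbF addbT.
Qed.

Lemma foldr_act_Z (s : seq 'I_n) f o :
  foldr act f [seq (true, j) | j <- s] o = \prod_(j <- s) (-1) ^+ (o j).2 *: f o.
Proof.
elim: s => [|j s IH] /=; first by rewrite big_nil scale1r.
by rewrite {1}/act {2}/letter_perm /= IH scalerA big_cons.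
Qed.

Definition shift_sgn c o : R[i] := \prod_(j | c j) (-1) ^+ (o j).1.

Lemma pauli_wordE c d f o :
  foldr act f (pauli_word c d) o =
  chi d (second o) *: (shift_sgn c o *: f (shift_second c o)).
Proof.
rewrite foldr_cat foldr_act_Z foldr_act_X; last exact: filter_uniq (enum_uniq 'I_n).
rewrite !big_filter !big_enum_cond; congr (_ *: (_ *: f _)).
  rewrite /chi big_mkcond; apply: eq_bigr => i _.
  by rewrite ffunE; case: (d i).
congr shift_second; apply/ffunP => i.
by rewrite ffunE mem_filter mem_enum andbT.
Qed.

Lemma size_pauli_word c d : (size (pauli_word c d) <= 2 * n)%N.
Proof.
have le_n (p : pred 'I_n) : (size [seq j <- enum 'I_n | p j] <= n)%N.
  by rewrite size_filter (leq_trans (count_size _ _)) // size_enum_ord.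
by rewrite size_cat !size_map mul2n -addnn leq_add.
Qed.

Lemma pauli_word_sum (e : bool * 'I_n -> R) c d : (forall t, 0 <= e t) ->
  \sum_(t <- pauli_word c d) e t <= \sum_j e (true, j) + \sum_j e (false, j).
Proof.
move=> e0; rewrite big_cat !big_map !big_filter !big_enum_cond /=.
by apply: lerD; rewrite big_mkcond; apply: ler_sum => j _; case: ifP.
Qed.

Lemma norm_shift_sgn c o : complex.Re `|shift_sgn c o| = 1.
Proof.
rewrite normr_prod big1 // => j _.
by rewrite normrX normrN1 expr1n.
Qed.

(** For each of the [4 ^ n] Pauli words, at least [1 - delta] of the squared norm lies in the frame
    of [f]. Summed over all words, each of the [r] frame functions captures at most [2 ^ n]. *)
Lemma dimension_bound f (delta : R) :
  \sum_o nsq (f o) = 1 ->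
  (forall c d, \sum_o nsq (foldr act f (pauli_word c d) o -
                           word letter_op (pauli_word c d) (f o)) <= delta) ->
  exists r, (exists e : 'I_r -> H, lin_indep e) /\ (1 - delta) * 2 ^+ n <= r%:R.
Proof.
move=> f1 fd; have [r [u [h [ie ou fE]]]] := orthonormal_frame f.
exists r; split=> //.
pose T c d := foldr act f (pauli_word c d).
have T1 c d : \sum_o nsq (T c d o) = 1.
  by rewrite (foldr_act_nsq letter_sgn letter_perm_inj).
have bes c d : 1 - \sum_k nsq (\sum_o (u k o)^* *: T c d o) <= delta.
  apply: le_trans (fd c d); rewrite -(T1 c d).
  apply: le_trans (bessel (fun k => word letter_op (pauli_word c d) (h k)) (T c d) ou) _.
  (* The word operator, applied to the expansion of [f], acts on the vectors [h k] alone. *)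
  rewrite le_eqVlt; apply/orP; left; apply/eqP; apply: eq_bigr => o _.
  congr (nsq (_ - _)); rewrite fE linear_sum; apply: eq_bigr => k _.
  by rewrite linearZ.
have cardb : #|{: bits}| = (2 ^ n)%N by rewrite card_ffun card_bool card_ord.
have sum_const (x : R) : \sum_(c : bits) \sum_(d : bits) x = 2 ^+ n * 2 ^+ n * x.
  by rewrite !sumr_const cardb -mulrnA -[LHS]mulr_natl natrM natrX.
have sum1 : \sum_c \sum_d (1 - \sum_k nsq (\sum_o (u k o)^* *: T c d o)) <=
    \sum_(c : bits) \sum_(d : bits) delta.
  by apply: ler_sum => c _; apply: ler_sum => d _.
have unorm k : \sum_o complex.Re `|(u k o)^*| ^+ 2 = 1.
  apply: complexI; rewrite realc_sum.
  transitivity ((k == k)%:R : R[i]); last by rewrite eqxx.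
  rewrite -ou; apply: eq_bigr => o _; rewrite norm_conjC.
  rewrite expr2 realcM RRe_real ?normr_real // -expr2.
  by rewrite normCKC.
have tw k : \sum_c \sum_d nsq (\sum_o (u k o)^* *: T c d o) <= 2 ^+ n.
  have := @twirl_bound R H n (fun o => (u k o)^*) shift_sgn f norm_shift_sgn.
  rewrite unorm f1 !mulr1; apply: le_trans.
  rewrite le_eqVlt; apply/orP; left; apply/eqP.
  apply: eq_bigr => c _; apply: eq_bigr => d _; congr nsq.
  by apply: eq_bigr => o _; rewrite /T pauli_wordE.
have sum2 : \sum_c \sum_d \sum_k nsq (\sum_o (u k o)^* *: T c d o) <= r%:R * 2 ^+ n.
  under eq_bigr do rewrite exchange_big.
  rewrite exchange_big /=.
  apply: (@le_trans _ _ (\sum_(k < r) 2 ^+ n)).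
    by apply: ler_sum => k _; exact: tw.
  by rewrite sumr_const card_ord mulr_natl.
have p0 : 0 < (2 : R) ^+ n by rewrite exprn_gt0.
move: sum1; under eq_bigr do rewrite sumrB; rewrite sumrB.
rewrite !sum_const mulr1.
move: sum2; set S := \sum_c _; set q := (2 : R) ^+ n in p0 *.
move=> le_S le_q; rewrite -(ler_pM2r p0).
have -> : (1 - delta) * q * q = q * q - q * q * delta by ring.
by rewrite lerBlDl -lerBlDr (le_trans _ le_q) // lerB.
Qed.

Lemma hdim_ge r : (exists e : 'I_r -> H, lin_indep e) -> ((r%:R)%:E <= hdim H)%E.
Proof. by move=> [e ie]; apply: ereal_sup_ubound; exists r, e. Qed.

Lemma protocol_dimension (psi : H) (eps : R) : (0 < n)%N -> nsq psi = 1 ->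
  1 - eps <= accept_prob X Z psi ->
  (((1 - 16 * n%:R ^+ 2 * eps) * 2 ^+ n)%:E <= hdim H)%E.
Proof.
move=> n0 psi1 acc.
pose f o := prodl (krausF X Z) (enum 'I_n) o psi.
have rX j : reflection (X j) by case: (XZ j).
have rZ j : reflection (Z j) by case: (XZ j).
pose e t := \sum_o nsq (act t f o - letter_op t (f o)).
have e0 t : 0 <= e t by apply: sumr_ge0 => o _; exact: nsq_ge0.
have esum : \sum_j e (true, j) + \sum_j e (false, j) <= 8 * n%:R * eps.
  (* By unfolding [act], the letter errors are those of the two orders. Each order gives [4 n] times
     its rejection probability, and these two probabilities add up to at most [2 * eps]. *)
  have -> : \sum_j e (true, j) = _ := reject_sum n0 rX rZ psi1.
  have -> : \sum_j e (false, j) = _ := reject_sum_swap n0 XZ psi1.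
  rewrite -mulrDr; have -> : 8 * n%:R * eps = 4 * n%:R * (2 * eps) by ring.
  rewrite ler_wpM2l ?mulr_ge0 //; move: acc; rewrite /accept_prob.
  set a := accept_prob_order X Z psi; set b := accept_prob_order Z X psi; lra.
have close c d : \sum_o nsq (foldr act f (pauli_word c d) o -
    word letter_op (pauli_word c d) (f o)) <= 16 * n%:R ^+ 2 * eps.
  apply: le_trans (approx_word letter_sgn letter_perm_inj letter_op_nsq _ _) _.
  (* A word has at most [2 n] letters, and their errors total at most [8 n eps]. *)
  have -> : 16 * n%:R ^+ 2 * eps = (2 * n)%:R * (8 * n%:R * eps) by rewrite natrM; ring.
  apply: ler_pM => //; first by apply: sumr_ge0 => t _; exact: e0.
    by rewrite ler_nat size_pauli_word.
  exact: le_trans (pauli_word_sum _ _ e0) esum.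
have f1 : \sum_o nsq (f o) = 1 by rewrite /f pass_total.
have [r [ie le_r]] := dimension_bound f1 close.
by apply: le_trans (hdim_ge ie); rewrite lee_fin.
Qed.

End Dimension.

Theorem corollary4p4 (R : realType) :
  exists C : R, 0 < C /\
    forall (n : nat) (H : hilbertType R) (psi : H)
      (X Z : 'I_n -> {linear H -> H}) (eps : R),
      (1 <= n)%N ->
      state psi ->
      (forall j, qubit (X j) (Z j)) ->
      0 <= eps ->
      1 - eps <= accept_prob X Z psi ->
      (((1 - C * n%:R ^+ 2 * eps) * 2 ^+ n)%:E <= hdim H)%E.
Proof.
exists 16; split=> // n H psi X Z eps n0 psi1 XZ _ acc.
by apply: protocol_dimension acc; rewrite // /nsq psi1 expr1n.
Qed.
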